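(* Let $p$ be a prime number and let $\xi\in\mathbb{Q}_p$ be transcendental over $\mathbb{Q}$. For any positive integer $k$, we have $$(k+1) \bigl( 1 + \lambda_{k+1} (\xi) \bigr) \ge k \bigl( 1 + \lambda_k (\xi) \bigr),$$ with equality if $\lambda_{k+1} (\xi) > 1$. Consequently, for every positive integer $k$ and every integer $n$ with $n \ge k$, we have $$\lambda_n (\xi) \ge \frac{k \lambda_k (\xi) - n + k}{n},$$ with equality if $\lambda_n (\xi) > 1$.
   Context: $|\cdot|_p$ is the usual $p$-adic absolute value on $\mathbb{Q}_p$, normalized by $|p|_p=p^{-1}$. For an integer $n\ge 1$ and $\xi\in\mathbb{Q}_p$, $\lambda_n(\xi)\in[-\infty,+\infty]$ denotes the supremum of the real numbers $\lambda$ such that, for arbitrarily large real numbers $X$, the inequalities $$\max\{|x_0|,\ldots,|x_n|\}\le X,\qquad 0<\max_{1\le m\le n}|x_0\xi^m-x_m|_p\le X^{-\lambda-1}$$ have a solution in integers $x_0,\ldots,x_n$. The inequalities and equalities are understood in the extended reals with the usual conventions for $+\infty$. *)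

(* Defs.v *)
From HB Require Import structures.
From mathcomp Require Import all_boot all_order all_algebra.
From mathcomp Require Import generic_quotient ring_quotient.
From mathcomp Require Import all_classical all_reals all_analysis.
From mathcomp Require Import ring.

Set Implicit Arguments.
Unset Strict Implicit.
Unset Printing Implicit Defensive.

Import Order.TTheory GRing.Theory Num.Theory.
Import numFieldNormedType.Exports.

Local Open Scope classical_set_scope.
Local Open Scope ring_scope.

(* The p-adic absolute value on rat: with v_p = logn p on nonzero integers,
   |a / b|_p = p ^ (v_p(b) - v_p(a)). *)
Definition ratp_abs (p : nat) (q : rat) : rat :=
  if q == 0 then 0
  else (p%:R : rat) ^ ((logn p `|denq q|)%:Z - (logn p `|numq q|)%:Z).

Section RatpAbs.
Variables (p : nat) (p_pr : prime p).
Local Notation abs := (ratp_abs p).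

Let p_gt0 : 0 < (p%:R : rat).
Proof. by rewrite ltr0n prime_gt0. Qed.
Let p_neq0 : (p%:R : rat) != 0.
Proof. exact: lt0r_neq0. Qed.
Let p_ge1 : 1 <= (p%:R : rat).
Proof. by rewrite (ler_nat _ 1) prime_gt0. Qed.

Lemma ratp_abs0 : abs 0 = 0.
Proof. by rewrite /ratp_abs eqxx. Qed.

Lemma ratp_abs_gt0 q : q != 0 -> 0 < abs q.
Proof. by rewrite /ratp_abs => /negPf ->; exact: exprz_gt0. Qed.

Lemma ratp_abs_ge0 q : 0 <= abs q.
Proof.
by have [->|/ratp_abs_gt0/ltW//] := eqVneq q 0; rewrite ratp_abs0.
Qed.

Lemma ratp_abs_eq0 q : (abs q == 0) = (q == 0).
Proof.
apply/idP/eqP => [|->]; last by rewrite ratp_abs0.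
by apply: contraTeq => /ratp_abs_gt0/lt0r_neq0.
Qed.

Lemma ratp_abs_frac (a b : int) : a != 0 -> b != 0 ->
  abs (a%:~R / b%:~R) = p%:R ^ ((logn p `|b|)%:Z - (logn p `|a|)%:Z).
Proof.
move=> a0 b0; set q := _ / _.
have aR0 : a%:~R != 0 :> rat by rewrite intr_eq0.
have bR0 : b%:~R != 0 :> rat by rewrite intr_eq0.
have q0 : q != 0 by rewrite mulf_neq0 // invr_eq0.
rewrite /ratp_abs (negPf q0).
have : (numq q * b = a * denq q)%R.
  by apply: (@intr_inj rat); rewrite !intrM numqE mulrAC divfK.
move/(congr1 absz)/(congr1 (logn p)); rewrite !abszM.
rewrite !lognM ?absz_gt0 ?denq_neq0 ?numq_eq0 // => /(congr1 Posz).
rewrite !PoszD => e; congr (_ ^ _); apply/eqP.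
by rewrite subr_eq addrAC eq_sym subr_eq addrC e addrC.
Qed.

Lemma ratp_absM q r : abs (q * r) = abs q * abs r.
Proof.
have [->|q0] := eqVneq q 0; first by rewrite !(mul0r, ratp_abs0).
have [->|r0] := eqVneq r 0; first by rewrite !(mulr0, ratp_abs0).
rewrite -[q]divq_num_den -[r]divq_num_den mulf_div -!intrM.
rewrite !ratp_abs_frac ?mulf_neq0 ?denq_neq0 ?numq_eq0 //.
rewrite !abszM !lognM ?absz_gt0 ?denq_neq0 ?numq_eq0 //.
by rewrite -expfzDr // !PoszD opprD addrACA.
Qed.

Lemma ratp_abs1 : abs 1 = 1.
Proof. by have := @ratp_abs_frac 1 1 isT isT; rewrite divr1 subrr expr0z. Qed.

Lemma ratp_absN q : abs (- q) = abs q.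
Proof. by rewrite /ratp_abs oppr_eq0 numqN denqN abszN. Qed.

Lemma ratp_absB q r : abs (q - r) = abs (r - q).
Proof. by rewrite -ratp_absN opprB. Qed.

Lemma ratp_absV q : abs q^-1 = (abs q)^-1.
Proof.
have [->|q0] := eqVneq q 0; first by rewrite ratp_abs0 !invr0 ratp_abs0.
apply: (mulIf (lt0r_neq0 (ratp_abs_gt0 q0))).
by rewrite mulVf ?ratp_abs_eq0// -ratp_absM mulVf// ratp_abs1.
Qed.

Lemma ratp_abs_int (m : int) : m != 0 -> abs m%:~R = p%:R ^- logn p `|m|.
Proof.
move=> m0; have := @ratp_abs_frac m 1 m0 isT.
by rewrite divr1 logn1 sub0r -exprnN.
Qed.

Lemma ratp_abs_int_le (m : int) (k : nat) :
  m != 0 -> (abs m%:~R <= p%:R ^- k) = (p ^ k %| `|m|)%N.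
Proof.
move=> m0; rewrite ratp_abs_int // pfactor_dvdn ?absz_gt0 //.
rewrite lef_pV2 ?posrE ?exprn_gt0 // ler_eXn2l //.
by rewrite (ltr_nat _ 1) prime_gt1.
Qed.

Lemma ratp_absD_int (a b : int) :
  abs (a + b)%:~R <= Num.max (abs a%:~R) (abs b%:~R).
Proof.
have [->|a0] := eqVneq a 0; first by rewrite add0r le_max lexx orbT.
have [->|b0] := eqVneq b 0; first by rewrite addr0 le_max lexx.
have [->|ab0] := eqVneq (a + b) 0.
  by rewrite ratp_abs0 le_max ratp_abs_ge0.
suff W k : (p ^ k %| `|a|)%N -> (p ^ k %| `|b|)%N ->
    abs (a + b)%:~R <= p%:R ^- k.
  have [ab|/ltnW ba] := leqP (logn p `|a|) (logn p `|b|).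
    rewrite le_max [X in _ <= X]ratp_abs_int //.
    by rewrite W // pfactor_dvdn ?absz_gt0.
  rewrite le_max [X in _ || (_ <= X)]ratp_abs_int //.
  by rewrite orbC W // pfactor_dvdn ?absz_gt0.
move=> ka kb; rewrite ratp_abs_int_le //.
have : ((p ^ k)%:Z %| a + b)%Z by apply: rpredD; rewrite dvdzE.
by rewrite dvdzE.
Qed.

Lemma ratp_absD q r : abs (q + r) <= Num.max (abs q) (abs r).
Proof.
have dq0 : (denq q)%:~R != 0 :> rat by rewrite intr_eq0 denq_neq0.
have dr0 : (denq r)%:~R != 0 :> rat by rewrite intr_eq0 denq_neq0.
set d : rat := (denq q)%:~R * (denq r)%:~R.
have d0 : d != 0 by rewrite mulf_neq0.
have Eq : q * d = (numq q * denq r)%:~R by rewrite intrM numqE mulrA.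
have Er : r * d = (numq r * denq q)%:~R.
  by rewrite intrM numqE -mulrA [X in r * X]mulrC.
clearbody d; have := ratp_absD_int (numq q * denq r) (numq r * denq q).
rewrite intrD -Eq -Er -mulrDl !ratp_absM -maxr_pMl ?ratp_abs_ge0 //.
by rewrite ler_pM2r // ratp_abs_gt0.
Qed.

Lemma ratp_absD_lt q r e : abs q < e -> abs r < e -> abs (q + r) < e.
Proof.
by move=> qe re; rewrite (le_lt_trans (ratp_absD q r))// gt_max qe.
Qed.

Lemma ratp_absBB_le q r : `|abs q - abs r| <= abs (q - r).
Proof.
have W (s t : rat) : abs s - abs t <= abs (s - t).
  have := ratp_absD (s - t) t; rewrite subrK lerBlDr => /le_trans; apply.
  by rewrite ge_max lerDl lerDr !ratp_abs_ge0.
by rewrite ler_norml W andbT lerNl opprB ratp_absB W.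
Qed.

End RatpAbs.

Definition ratp_cauchy (p : nat) : {pred nat -> rat} := fun u =>
  `[< forall e : rat, 0 < e -> exists N, forall m n,
        (N <= m)%N -> (N <= n)%N -> ratp_abs p (u m - u n) < e >].

Section Cauchy.
Variables (p : nat) (p_pr : prime p).
Local Notation abs := (ratp_abs p).

Lemma ratp_cauchy_bounded u : u \in ratp_cauchy p ->
  exists2 B : rat, 0 < B & forall n, abs (u n) < B.
Proof.
move=> /asboolP /(_ 1 ltr01) [N uN].
exists (1 + \sum_(i < N.+1) abs (u i)) => [|n].
  by rewrite ltr_pwDl // sumr_ge0 // => i _; exact: ratp_abs_ge0.
have leS k : (k < N.+1)%N -> abs (u k) <= \sum_(i < N.+1) abs (u i).
  move=> kN; rewrite (bigD1 (Ordinal kN)) //= lerDl sumr_ge0 // => i _.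
  exact: ratp_abs_ge0.
have [nN|Nn] := ltnP n N.
  by rewrite ltr_pwDl // leS // ltnW.
rewrite -(subrK (u N) (u n)) ratp_absD_lt //.
  by rewrite (lt_le_trans (uN _ _ Nn (leqnn N))) // lerDl sumr_ge0 // => i _;
    exact: ratp_abs_ge0.
by rewrite ltr_pwDl // leS.
Qed.

Lemma ratp_cauchy_subring : subring_closed (ratp_cauchy p).
Proof.
split=> [|u v /asboolP cu /asboolP cv|u v cu cv]; apply/asboolP => e e0.
- by exists 0%N => m n _ _; rewrite subrr ratp_abs0.
- have [N uN] := cu e e0; have [M vM] := cv e e0.
  exists (maxn N M) => m n; rewrite !geq_max => /andP[Nm Mm] /andP[Nn Mn].
  have -> : (u - v) m - (u - v) n = (u m - u n) + (v n - v m).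
    rewrite -[(u - v) m]/(u m - v m) -[(u - v) n]/(u n - v n); ring.
  by rewrite ratp_absD_lt ?uN ?vM.
- have [B B0 uB] := ratp_cauchy_bounded cu.
  have [C C0 vC] := ratp_cauchy_bounded cv.
  move/asboolP in cu; move/asboolP in cv.
  have [N uN] := cu (e / C) (divr_gt0 e0 C0).
  have [M vM] := cv (e / B) (divr_gt0 e0 B0).
  exists (maxn N M) => m n; rewrite !geq_max => /andP[Nm Mm] /andP[Nn Mn].
  have -> : (u * v) m - (u * v) n = (u m - u n) * v m + u n * (v m - v n).
    rewrite -[(u * v) m]/(u m * v m) -[(u * v) n]/(u n * v n); ring.
  rewrite ratp_absD_lt // ratp_absM //.
    have := uN _ _ Nm Nn; rewrite ltr_pdivlMr //; apply: le_lt_trans.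
    by rewrite ler_wpM2l ?ratp_abs_ge0 // ltW.
  have := vM _ _ Mm Mn; rewrite ltr_pdivlMr // mulrC; apply: le_lt_trans.
  by rewrite ler_wpM2r ?ratp_abs_ge0 // ltW.
Qed.

End Cauchy.

Record cseq (p : nat) (p_pr : prime p) :=
  CSeq { cseq_val :> nat -> rat; cseqP : cseq_val \in ratp_cauchy p }.

Section CauchyRing.
Variables (p : nat) (p_pr : prime p).
Local Notation cseq := (cseq p_pr).
Local Notation abs := (ratp_abs p).

HB.instance Definition _ := GRing.isSubringClosed.Build (nat -> rat)
  (ratp_cauchy p) (ratp_cauchy_subring p_pr).
HB.instance Definition _ := [isSub for @cseq_val p p_pr].
HB.instance Definition _ := [Choice of cseq by <:].
HB.instance Definition _ := [SubChoice_isSubComNzRing of cseq by <:].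

Definition cseq_null : {pred cseq} := fun u =>
  `[< forall e : rat, 0 < e -> exists N, forall n, (N <= n)%N -> abs (u n) < e >].

Lemma cseq_null_idealr : idealr_closed cseq_null.
Proof.
split=> [||a u v /asboolP u0 /asboolP v0]; first 1 last.
- apply/asboolP => /(_ 1 ltr01) [N /(_ N (leqnn N))].
  by rewrite /= ratp_abs1 // ltxx.
- apply/asboolP => e e0.
  have [B B0 aB] := ratp_cauchy_bounded p_pr (cseqP a).
  have [N uN] := u0 (e / B) (divr_gt0 e0 B0); have [M vM] := v0 e e0.
  exists (maxn N M) => n; rewrite geq_max => /andP[Nn Mn].
  apply: ratp_absD_lt; rewrite ?vM //.  rewrite ratp_absM //.
  have := uN _ Nn; rewrite ltr_pdivlMr // mulrC; apply: le_lt_trans.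
  by rewrite ler_wpM2r ?ratp_abs_ge0 // ltW //; exact: aB.
- by apply/asboolP => e e0; exists 0%N => n _; rewrite /= ratp_abs0.
Qed.

HB.instance Definition _ := isIdealr.Build cseq cseq_null cseq_null_idealr.

(* Q_p, the completion of Q with respect to |.|_p: Cauchy sequences modulo null
   sequences. *)
Definition padic : Type := {ideal_quot cseq_null}.
HB.instance Definition _ := GRing.ComNzRing.on padic.
HB.instance Definition _ := EqQuotient.on padic.

End CauchyRing.
Arguments cseq_null {p} p_pr.

Section PadicField.
Variables (p : nat) (p_pr : prime p).
Local Notation cseq := (cseq p_pr).
Local Notation padic := (padic p_pr).
Local Notation abs := (ratp_abs p).

Lemma padic_pi_eq0 (u : cseq) :
  (\pi_padic u == 0 :> padic)%qT = (u \in cseq_null p_pr).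
Proof. by rewrite -[0](rmorph0 (\pi_padic)%qT) -Quotient.idealrBE subr0. Qed.

Lemma cseq_bounded_below (u : cseq) : u \notin cseq_null p_pr ->
  exists2 c : rat, 0 < c &
    exists N, forall n, (N <= n)%N -> c <= abs (u n).
Proof.
move=> /asboolPn /existsNP[c /not_implyP[c0 uc]]; exists c => //.
have /asboolP /(_ c c0) [N uN] := cseqP u; exists N => n Nn.
rewrite leNgt; apply/negP => unc; apply: uc; exists N => m Nm.
by rewrite -(subrK (u n) (u m)) ratp_absD_lt // uN.
Qed.

Lemma cseq_inv_subproof (u : cseq) : u \notin cseq_null p_pr ->
  (fun n => (u n)^-1) \in ratp_cauchy p.
Proof.
move=> /cseq_bounded_below [c c0 [N cu]]; apply/asboolP => e e0.
have /asboolP /(_ (e * (c * c))) := cseqP u.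
case=> [|M uM]; first by rewrite !mulr_gt0.
exists (maxn N M) => m n; rewrite !geq_max => /andP[Nm Mm] /andP[Nn Mn].
have um0 : 0 < abs (u m) by rewrite (lt_le_trans c0) // cu.
have un0 : 0 < abs (u n) by rewrite (lt_le_trans c0) // cu.
have {}um0' : u m != 0 by rewrite -(ratp_abs_eq0 p_pr) gt_eqF.
have {}un0' : u n != 0 by rewrite -(ratp_abs_eq0 p_pr) gt_eqF.
have -> : (u m)^-1 - (u n)^-1 = (u n - u m) / (u m * u n).
  by field; apply/andP.
rewrite !(ratp_absM, ratp_absV) // ltr_pdivrMr ?mulr_gt0 //.
rewrite (lt_le_trans (uM _ _ Mn Mm)) // ler_pM2l //.
by rewrite ler_pM // ?cu // ltW.
Qed.

Definition padic_inv (x : padic) : padic :=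
  if x == 0 then 0
  else (\pi_padic (insubd (0 : cseq) (fun n => (repr x n)^-1)))%qT.

Lemma padic_mulVf (x : padic) : x != 0 -> padic_inv x * x = 1.
Proof.
move=> x0; rewrite /padic_inv (negPf x0).
have u0 : repr x \notin cseq_null p_pr by rewrite -padic_pi_eq0 reprK.
rewrite -[X in _ * X]reprK -[1](rmorph1 (\pi_padic)%qT) -rmorphM.
apply/eqP; rewrite -Quotient.idealrBE; apply/asboolP => e e0.
have [c c0 [N cu]] := cseq_bounded_below u0.
exists N => n Nn; set v := insubd _ _.
have -> : (v * repr x - 1 : cseq) n = v n * repr x n - 1 by [].
rewrite /v [cseq_val _]insubdK ?cseq_inv_subproof //.
rewrite mulVf ?subrr ?ratp_abs0 //.
by rewrite -(ratp_abs_eq0 p_pr) gt_eqF // (lt_le_trans c0) // cu.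
Qed.

Lemma padic_inv0 : padic_inv 0 = 0.
Proof. by rewrite /padic_inv eqxx. Qed.

HB.instance Definition _ :=
  GRing.ComNzRing_isField.Build padic padic_mulVf padic_inv0.

End PadicField.

(* The extension of |.|_p to Q_p, as the limit of the absolute values along a
   representative; it does not depend on the latter by padic_abs_pi below. *)
Definition padic_abs (R : realType) (p : nat) (p_pr : prime p)
    (x : padic p_pr) : R :=
  lim ((fun n => ratr (ratp_abs p (repr x n)) : R) @ \oo).

Section PadicAbs.
Variables (R : realType) (p : nat) (p_pr : prime p).
Local Notation cseq := (cseq p_pr).
Local Notation padic := (padic p_pr).
Local Notation abs := (ratp_abs p).

Let rat_gt (e : R) : 0 < e -> exists2 c : rat, 0 < c & ratr c <= e.
Proof.
move=> e0; have := truncnS_gt (e^-1); move: (_.+1) => k ke.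
have k0 : 0 < k%:R :> R by rewrite (lt_trans _ ke) // invr_gt0.
exists k%:R^-1; first by rewrite invr_gt0 ltr0n -(ltr0n R).
by rewrite fmorphV rmorph_nat invf_ple ?posrE // ltW.
Qed.

Lemma cseq_abs_cvg (u : cseq) : cvgn (fun n => ratr (abs (u n)) : R).
Proof.
apply/cauchy_cvgP/cauchy_ballP => e /rat_gt[c c0 ce].
have /asboolP /(_ c c0) [N uN] := cseqP u.
rewrite near_map2; exists ([set n | (N <= n)%N], [set n | (N <= n)%N]) => /=.
  by split; exists N.
case=> m n /= [Nm Nn]; rewrite /ball /= -rmorphB -ratr_norm.
rewrite (lt_le_trans _ ce) // ltr_rat.
by rewrite (le_lt_trans (ratp_absBB_le _ _ _)) // uN.
Qed.

Lemma padic_abs_pi (u : cseq) :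
  (fun n => ratr (abs (u n)) : R) @ \oo --> padic_abs R (\pi_padic u)%qT.
Proof.
set v := repr (\pi_padic u)%qT.
have : u - v \in cseq_null p_pr.
  by rewrite Quotient.idealrBE reprK.
move=> /asboolP uv; have /cvgrPdist_lt vL := @cseq_abs_cvg v.
apply/cvgrPdist_lt => e e0.
have e2 : 0 < e / 2 by rewrite divr_gt0.
have [c c0 ce] := rat_gt e2; have [N uvN] := uv c c0.
have uvn n : (N <= n)%N -> `|ratr (abs (v n)) - ratr (abs (u n)) : R| < e / 2.
  move=> Nn; rewrite -rmorphB -ratr_norm (lt_le_trans _ ce) // ltr_rat.
  rewrite (le_lt_trans (ratp_absBB_le _ _ _)) // ratp_absB //.
  exact: uvN.
near=> n.
rewrite -(subrK (ratr (abs (v n))) (padic_abs _ _)) -addrA.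
rewrite (le_lt_trans (ler_normD _ _)) // [e]splitr ltrD //.
  by near: n; exact: vL.
by apply: uvn; near: n; exists N.
Unshelve. all: by end_near. Qed.

Lemma cst_cauchy (q : rat) : (fun=> q) \in ratp_cauchy p.
Proof. by apply/asboolP => e e0; exists 0%N => *; rewrite subrr ratp_abs0. Qed.

Lemma padic_ratrE (q : rat) :
  ratr q = (\pi_padic (CSeq p_pr (cst_cauchy q)))%qT :> padic.
Proof.
have evalz (c : int) n : (c%:~R : cseq) n = c%:~R.
  rewrite -[LHS]/((\val (c%:~R : cseq) : nat -> rat) n) rmorph_int.
  have evaln (k : nat) : (k%:R : nat -> rat) n = k%:R.
    by elim: k => [//|k IHk]; rewrite -!natr1 -IHk.
  case: c => k; first by rewrite -!pmulrn evaln.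
  by rewrite NegzE !mulrNz -!pmulrn -evaln.
have piz (c : int) : (\pi_padic (c%:~R : cseq))%qT = c%:~R :> padic.
  exact: rmorph_int.
have d0 : (denq q)%:~R != 0 :> padic.
  rewrite -piz padic_pi_eq0; apply/asboolPn.
  have dq0 : 0 < abs (denq q)%:~R by rewrite ratp_abs_gt0 // intr_eq0 denq_neq0.
  by move=> /(_ _ dq0) [N /(_ N (leqnn N))]; rewrite evalz ltxx.
apply: (mulIf d0); rewrite /ratr divfK // -!piz -rmorphM; congr (\pi_padic _)%qT.
apply/val_inj/funext => n; rewrite -[LHS]/((_ : cseq) n) -[RHS]/((_ : cseq) n).
by rewrite evalz -[RHS]/(q * ((denq q)%:~R : cseq) n) evalz numqE.
Qed.

Lemma padic_abs_ratr (q : rat) :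
  padic_abs R (ratr q : padic) = ratr (abs q).
Proof.
rewrite padic_ratrE; rewrite -(cvg_lim (@norm_hausdorff _ R^o) (@padic_abs_pi _)).
have h : limn (fun _ : nat => ratr (abs q) : R) = ratr (abs q).
  exact: lim_cst.
refine h.
Qed.

Lemma padic_absM (x y : padic) :
  padic_abs R (x * y) = padic_abs R x * padic_abs R y.
Proof.
rewrite -[x]reprK -[y]reprK -rmorphM.
rewrite -(cvg_lim (@norm_hausdorff _ R^o)
  (cvgM (@padic_abs_pi (repr x)) (@padic_abs_pi (repr y)))).
rewrite -(cvg_lim (@norm_hausdorff _ R^o) (@padic_abs_pi _)).
by congr (lim (_ @ \oo)); apply/funext => n /=; rewrite ratp_absM // rmorphM.
Qed.

Lemma padic_absD (x y : padic) :
  padic_abs R (x + y) <= Num.max (padic_abs R x) (padic_abs R y).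
Proof.
rewrite -[x]reprK -[y]reprK -rmorphD.
apply/ler_addgt0Pr => e e0; set M := Num.max _ _.
have [xM yM] : padic_abs R (\pi_padic (repr x))%qT < M + e /\
    padic_abs R (\pi_padic (repr y))%qT < M + e.
  by split; rewrite ltr_pwDr // le_max lexx ?orbT.
apply: (cvgr_to_le (@padic_abs_pi _)); near=> n.
have xn : ratr (abs (repr x n)) < M + e.
  by near: n; exact: cvgr_lt (@padic_abs_pi _) _ xM.
have yn : ratr (abs (repr y n)) < M + e.
  by near: n; exact: cvgr_lt (@padic_abs_pi _) _ yM.
have := @ratp_absD _ p_pr (repr x n) (repr y n).
rewrite le_max -!(ler_rat R) => /orP[] h; first exact: le_trans h (ltW xn).
exact: le_trans h (ltW yn).
Unshelve. all: by end_near. Qed.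

Lemma padic_abs_eq0 (x : padic) : (padic_abs R x == 0) = (x == 0).
Proof.
have r0 : ratr 0 = 0 :> padic := ratr_int padic 0.
have r1 : ratr 1 = 1 :> padic := ratr_int padic 1.
apply/eqP/eqP => [x0|->]; last first.
  by rewrite -r0 padic_abs_ratr ratp_abs0 rmorph0.
apply/eqP; apply: contraTT isT => xn0.
have /eqP := padic_absM x x^-1; rewrite x0 mul0r divff //.
by rewrite -r1 padic_abs_ratr ratp_abs1 // rmorph1 oner_eq0.
Qed.

Lemma padic_dense (x : padic) (e : R) : 0 < e ->
  exists q : rat, padic_abs R (x - ratr q) < e.
Proof.
move=> /rat_gt[c c0 ce]; set u := repr x.
have c2 : 0 < c / 2 by rewrite divr_gt0.
have /asboolP /(_ _ c2) [N uN] := cseqP u.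
exists (u N); rewrite -[x]reprK padic_ratrE -rmorphB.
suff: padic_abs R (\pi_padic (u - CSeq p_pr (cst_cauchy (u N))))%qT
    <= ratr (c / 2).
  move=> /le_lt_trans; apply; rewrite (lt_le_trans _ ce) // ltr_rat.
  by rewrite ltr_pdivrMr // ltr_pMr // ltr1n.
apply: (cvgr_to_le (@padic_abs_pi _)).
by exists N => // n /= Nn; rewrite ler_rat ltW // uN.
Qed.

End PadicAbs.

(* The exponent of simultaneous approximation of xi, ..., xi ^+ n. The base 0 of
   the maxima is harmless, all the terms being nonnegative, and X `^ _ (which is
   a genuine power only for X > 0) is only relevant for large X. *)
Definition padic_lambda (R : realType) (p : nat) (p_pr : prime p) (n : nat)
    (xi : padic p_pr) : \bar R :=
  ereal_sup [set lam%:E | lam in [set lam : R |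
    forall B : R, exists2 X : R, B <= X &
      exists x : 'I_n.+1 -> int,
        \big[Num.max/0]_(i < n.+1) `|x i|%:~R <= X /\
        0 < \big[Num.max/0]_(m < n.+1 | (0 < m)%N)
              padic_abs R ((x ord0)%:~R * xi ^+ m - (x m)%:~R)
          <= X `^ (- lam - 1)]].

(* Main.v *)
Require Import Defs.
From mathcomp Require Import all_boot all_order all_algebra.
From mathcomp Require Import all_classical all_reals all_analysis.
From mathcomp Require Import ring lra zify.

(** Write L(n) for n * (1 + lambda_n). Everything follows from three facts:

      lambda_n >= 0;   L(k) <= L(k + 1);   L(n) <= L(1) if lambda_n > 1.

    Together they give L(1) <= L(k) <= L(n) <= L(1) whenever lambda_n > 1 and
    1 <= k <= n, so that all these numbers coincide; solving L(k) <= L(n) for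
    lambda_n gives the second half of the theorem (lee_rescale).

    The monotonicity of L is simul_approx_succ. Let x = (x_0, ..., x_k) have size
    at most X and p-adic errors x_0 * xi ^+ m - x_m of absolute value at most e.
    By the pigeonhole principle some nonzero integer vector a of size
    O(X ^ (1 / k)) is orthogonal to x. Let a_d be its last nonzero entry. The
    relation a_0 x_0 + ... + a_d x_d = 0 can be shifted p-adically, multiplication
    by xi ^+ j being almost the shift x_i |-> x_(i + j) (shifted_relation).
    Shifted so that the index d lands on k + 1, it reads

      a_d x_0 xi ^+ k.+1 ~ - (a_0 x_(k + 1 - d) + ... + a_(d - 1) x_k),

    whose right-hand side is an integer. Appending it to a_d * x gives a vector
    in dimension k + 1, of size O(X ^ (1 + 1 / k)) and with errors O(e). No
    precision is lost because integers have p-adic absolute value at most 1.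

    The descent to dimension 1 is approx_exponent_descent. If lambda > 1, the
    minors x_0 x_(m + 1) - x_1 x_m are integers of size O(X ^+ 2) and of p-adic
    absolute value O(X ^ (- lambda - 1)), hence they vanish. So
    x = t * (q ^+ n, q ^+ n.-1 * r, ..., r ^+ n) with q and r coprime
    (geometric_of_minors), and q, r have size at most (X / |t|) ^ (1 / n) while
    q * xi - r is about as small as the errors of x. *)

Set Implicit Arguments.
Unset Strict Implicit.
Unset Printing Implicit Defensive.

Import Order.TTheory GRing.Theory Num.Theory.
Local Open Scope ring_scope.

(** * The absolute value on Q_p *)

Section PadicAbsolute.
Variables (R : realType) (p : nat) (p_pr : prime p).
Local Notation padic := (padic p_pr).
Local Notation abs := (@padic_abs R p p_pr).

Lemma padic_abs_int (m : int) :
  abs m%:~R = ratr (ratp_abs p (m%:~R)).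
Proof. by rewrite -padic_abs_ratr ratr_int. Qed.

Lemma padic_abs_ge0 (x : padic) : 0 <= abs x.
Proof.
rewrite -[x]reprK; apply: (cvgr_to_ge (@padic_abs_pi R _ _ _)).
by near=> n; rewrite ler0q ratp_abs_ge0.
Unshelve. all: by end_near. Qed.

Lemma padic_abs0 : abs 0 = 0.
Proof. by apply/eqP; rewrite padic_abs_eq0. Qed.

Lemma padic_abs1 : abs 1 = 1.
Proof. by rewrite (padic_abs_int 1) ratp_abs1 ?rmorph1. Qed.

Lemma padic_absN (x : padic) : abs (- x) = abs x.
Proof.
rewrite -mulN1r padic_absM -(intrN _ 1) padic_abs_int.
by rewrite intrN ratp_absN ratp_abs1 // rmorph1 mul1r.
Qed.

Lemma padic_absX (x : padic) n : abs (x ^+ n) = abs x ^+ n.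
Proof.
elim: n => [|n IHn]; first by rewrite !expr0 padic_abs1.
by rewrite !exprS padic_absM IHn.
Qed.

Lemma padic_absD_le (x y : padic) (b : R) :
  abs x <= b -> abs y <= b -> abs (x + y) <= b.
Proof.
by move=> xb yb; apply: le_trans (padic_absD _ _ _) _; rewrite ge_max xb.
Qed.

Lemma padic_absB_le (x y : padic) (b : R) :
  abs x <= b -> abs y <= b -> abs (x - y) <= b.
Proof. by move=> xb yb; apply: padic_absD_le => //; rewrite padic_absN. Qed.

Lemma padic_abs_sum_le (I : Type) (s : seq I) (P : pred I) (F : I -> padic)
    (b : R) : 0 <= b -> (forall i, P i -> abs (F i) <= b) ->
  abs (\sum_(i <- s | P i) F i) <= b.
Proof.
move=> b0 Fb; apply: (big_ind (fun x => abs x <= b)) => //.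
- by rewrite padic_abs0.
- by move=> x y; exact: padic_absD_le.
Qed.

Lemma padic_abs_int_le1 (m : int) : abs m%:~R <= 1.
Proof.
have [->|m0] := eqVneq m 0; first by rewrite padic_abs0.
rewrite padic_abs_int -[leRHS](rmorph1 (ratr : rat -> R)) ler_rat ratp_abs_int //.
by rewrite invf_le1 ?exprn_gt0 ?exprn_ege1 ?ltr0n ?(ler_nat _ 1) ?prime_gt0.
Qed.

(** Half of the product formula: p ^ v_p(m) divides m, so it is at most |m|. *)
Lemma padic_abs_int_ge (m : int) (B : R) :
  m != 0 -> `|m|%:~R <= B -> B^-1 <= abs m%:~R.
Proof.
move=> m0 mB.
have m_gt0 : 0 < `|m|%:~R :> R by rewrite ltr0z normr_gt0.
rewrite padic_abs_int ratp_abs_int // fmorphV rmorphXn /= ratr_nat.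
rewrite lef_pV2 ?posrE ?exprn_gt0 ?ltr0n ?prime_gt0 ?(lt_le_trans m_gt0) //.
apply: le_trans mB; rewrite -natrX -abszE -pmulrn ler_nat.
by rewrite dvdn_leq ?absz_gt0 // pfactor_dvdnn.
Qed.

(** The gap principle turning p-adic closeness into an exact equality. *)
Lemma padic_int_eq0 (m : int) (B : R) :
  0 < B -> `|m|%:~R <= B -> abs m%:~R < B^-1 -> m = 0.
Proof.
move=> B0 mB; rewrite ltNge => /negP mV; apply/eqP.
by apply: contra_notT mV => m0; exact: padic_abs_int_ge.
Qed.

Lemma padic_abs_coprime (q r : int) :
  coprimez q r -> abs q%:~R < 1 -> abs r%:~R = 1.
Proof.
have abs1 (m : int) : ~~ (p %| `|m|)%N -> abs m%:~R = 1.
  move=> pm; have m0 : m != 0 by apply: contra pm => /eqP ->.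
  rewrite padic_abs_int ratp_abs_int // lognE p_pr absz_gt0 m0 (negPf pm) /=.
  by rewrite expr0 invr1 rmorph1.
move=> qr q1; apply: (abs1); apply: contraL qr => pr.
have pq : (p %| `|q|)%N by apply: contraTT q1 => /abs1 ->; rewrite ltxx.
rewrite coprimezE; apply/negP => /eqP g1.
have := dvdn_gcd p `|q| `|r|; rewrite pq pr g1 dvdn1 => /eqP p1.
by move: p_pr; rewrite p1.
Qed.

Lemma transcendental_irrational (xi : padic) (q r : int) :
  ~ algebraicOver (ratr : rat -> padic) xi -> q != 0 ->
  0 < abs (q%:~R * xi - r%:~R).
Proof.
move=> xi_tr q0; rewrite lt0r padic_abs_ge0 andbT padic_abs_eq0.
apply: contra_notN xi_tr => /eqP qr.
exists (q%:~R *: 'X - (r%:~R)%:P).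
  apply/eqP => /(congr1 (fun P : {poly rat} => P`_1)) /eqP.
  by rewrite !coefE /= subr0 mulr1 intr_eq0 (negPf q0).
have r0 : ratr 0 = 0 :> padic := ratr_int padic 0.
rewrite rootE (@horner_coef_wide _ 2) => [|].
  rewrite !big_ord_recl big_ord0 /= !coef_map_id0 // !coefE /= mulr0 !mulr1.
  by rewrite sub0r subr0 -mulrNz !ratr_int mulrNz addr0 addrC qr.
rewrite map_polyE (leq_trans (size_Poly _)) // size_map.
rewrite (leq_trans (size_polyD _ _)) //.
by rewrite geq_max size_polyN (leq_trans (size_scale_leq _ _)) ?size_polyX //
  (leq_trans (size_polyC_leq1 _)).
Qed.

End PadicAbsolute.

(** * Exponents of simultaneous approximation *)

Section Exponent.
Variables (R : realType) (p : nat) (p_pr : prime p) (xi : padic p_pr).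
Local Notation abs := (@padic_abs R p p_pr).

Lemma powR_unbounded (c D : R) : 0 < c ->
  exists2 B : R, 1 <= B & forall X, B <= X -> D < X `^ c.
Proof.
move=> c0; set E := Num.max D 1 + 1.
have E1 : 1 <= E by rewrite /E lerDr le_max ler01 orbT.
have E0 : 0 <= E by rewrite (le_trans ler01).
have cV0 : 0 <= c^-1 by rewrite invr_ge0 ltW.
exists (E `^ c^-1) => [|X EX].
  by rewrite -(powRr0 E); exact: ler_powR.
have DE : D < E by rewrite /E ltr_pwDr // le_max lexx.
apply: lt_le_trans DE _.
rewrite -[leLHS]powRr1 // -(mulVf (lt0r_neq0 c0)) ?powRrM.
apply: ge0_ler_powR => //; rewrite ?nnegrE ?powR_ge0 ?(ltW c0) //.
exact: le_trans (powR_ge0 _ _) EX.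
Qed.

Lemma powR_lt (X r s : R) : 1 < X -> (X `^ r < X `^ s) = (r < s).
Proof.
move=> X1; have X0 : 0 < X by exact: lt_trans X1.
by rewrite /powR (gt_eqF X0) ltr_expR ltr_pM2r // ln_gt0.
Qed.

(** For irrational xi the
    condition x 0 != 0 makes the error at m = 1 nonzero; it replaces the
    positivity requirement in the definition of the exponent. *)
Definition simul_approx (n : nat) (H e : R) (x : nat -> int) : Prop :=
  [/\ x 0 != 0,
      forall m, (m <= n)%N -> `|x m|%:~R <= H
    & forall m, (m <= n)%N -> abs ((x 0)%:~R * xi ^+ m - (x m)%:~R) <= e].

Definition approx_exponent (n : nat) (lam : R) : Prop :=
  forall B : R, exists2 X : R, B <= X &
    exists x, simul_approx n X (X `^ (- lam - 1)) x.

(** For a positive exponent the vectors witnessing it have x 0 != 0: otherwise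
    the coordinates themselves would be nonzero integers of size at most X and
    of p-adic absolute value below 1 / X, against the product formula. *)
Lemma approx_exponent_of_lambda n lam : 0 < lam ->
    (forall B : R, exists2 X : R, B <= X &
      exists x : 'I_n.+1 -> int,
        \big[Num.max/0]_(i < n.+1) `|x i|%:~R <= X /\
        0 < \big[Num.max/0]_(m < n.+1 | (0 < m)%N)
              abs ((x ord0)%:~R * xi ^+ m - (x m)%:~R)
          <= X `^ (- lam - 1)) ->
  approx_exponent n lam.
Proof.
move=> lam0 lam_good B.
have [X] := lam_good (Num.max B 2); rewrite ge_max => /andP[BX X2] [x].
case=> /bigmax_leP[X0 xX] /andP[/bigmax_gtP[|[j _ xj0]]]; first by rewrite ltxx.
move=> /bigmax_leP[e0 xe]; exists X => //; exists (fun m => x (inord m)); split.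
- have -> : inord 0 = ord0 :> 'I_n.+1 by apply: val_inj; rewrite /= inordK.
  apply: contraTN xj0 => /eqP x00.
  have [j0|j0] := posnP (j : nat).
    have -> : j = ord0 by apply: val_inj.
    by rewrite x00 mul0r subrr padic_abs0 ltxx.
  have := xe j j0; rewrite x00 mul0r sub0r padic_absN => xje.
  rewrite -leNgt (_ : x j = 0) ?padic_abs0 //.
  apply: (@padic_int_eq0 R p p_pr _ X); rewrite ?xX //; first lra.
  apply: le_lt_trans xje _; rewrite -powR_inv1; last lra.
  by rewrite powR_lt; lra.
- by move=> m mn; exact: xX.
- move=> m mn.
  have -> : inord 0 = ord0 :> 'I_n.+1 by apply: val_inj; rewrite /= inordK.
  have [->|m0] := posnP m.
    have -> : inord 0 = ord0 :> 'I_n.+1 by apply: val_inj; rewrite /= inordK.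
    by rewrite expr0 mulr1 subrr padic_abs0.
  by have := xe (inord m); rewrite inordK //; apply.
Qed.

(** Below the threshold t the bound M holds for free, so that the exponents to
    be treated are positive, or even greater than 1, as the two arguments that
    follow require. *)
Lemma padic_lambda_le n (t : R) (M : \bar R) : 0 <= t -> (t%:E <= M)%E ->
  (forall lam, t < lam -> approx_exponent n lam -> (lam%:E <= M)%E) ->
  (padic_lambda R n xi <= M)%E.
Proof.
move=> t0 tM ltM; apply: ge_ereal_sup => _ [lam lam_good <-].
have [lamt|tlam] := leP lam t.
  by apply: le_trans tM; rewrite lee_fin.
by apply: ltM => //; apply: approx_exponent_of_lambda => //; exact: le_lt_trans tlam.
Qed.

Lemma padic_lambda_gt n (t : R) : 0 <= t -> (t%:E < padic_lambda R n xi)%E ->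
  exists2 lam, t < lam & approx_exponent n lam.
Proof.
move=> t0 /ereal_sup_gt[_ [lam lam_good <-]]; rewrite lte_fin => tlam.
by exists lam => //; apply: approx_exponent_of_lambda => //; exact: le_lt_trans tlam.
Qed.

(** Constants are irrelevant: in terms of the size bound C * X ^ a, the precision
    C * X ^ (- b) is the power - b / a up to a constant, which any loss e > 0
    in the exponent absorbs for large X. *)
Lemma padic_lambda_ge n (a b C : R) :
    ~ algebraicOver (ratr : rat -> padic p_pr) xi -> (0 < n)%N -> 0 < a ->
    (forall B : R, exists2 X : R, B <= X &
      exists x, simul_approx n (C * X `^ a) (C * X `^ (- b)) x) ->
  ((b / a - 1)%:E <= padic_lambda R n xi)%E.
Proof.
move=> xi_tr n0 a0 ex; apply/lee_subgt0Pr => e e0; rewrite -EFinB.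
set mu := b / a - 1 - e; set C' := Num.max C 1.
have C'1 : 1 <= C' by rewrite le_max lexx orbT.
have C'0 : 0 < C' by exact: lt_le_trans C'1.
apply: ereal_sup_ubound; exists mu => // B.
have [B1 B11 XB1] := @powR_unbounded a B a0.
have [B2 B21 XB2] := @powR_unbounded (a * e) (C / C' `^ (- mu - 1)) (mulr_gt0 a0 e0).
have [X] := ex (Num.max B1 B2); rewrite ge_max => /andP[B1X B2X] [x [x0 xH xe]].
have X0 : 0 < X by lra.
have Y0 : 0 < X `^ a by rewrite powR_gt0.
exists (C' * X `^ a).
  by rewrite (le_trans (ltW (XB1 X B1X))) // ler_peMl // ltW.
have CC' : C <= C' by rewrite le_max lexx.
have eE : C * X `^ (- b) <= (C' * X `^ a) `^ (- mu - 1).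
  rewrite powRM ?(ltW C'0) ?(ltW Y0) // -powRrM.
  have -> : a * (- mu - 1) = a * e + - b by rewrite /mu; field; lra.
  rewrite (@powRD _ X); last by rewrite (lt0r_neq0 X0) implybT.
  rewrite mulrA ler_wpM2r ?powR_ge0 //.
  by rewrite mulrC -ler_pdivrMr ?powR_gt0 // ltW // XB2.
exists (fun i => x i); split.
  apply/bigmax_leP; split=> [|i _]; first by rewrite mulr_ge0 // ltW.
  by rewrite (le_trans (xH i _)) ?ler_wpM2r ?(ltW Y0) // -ltnS ltn_ord.
apply/andP; split.
  apply/bigmax_gtP; right.
  have i1 : (1 < n.+1)%N by rewrite ltnS.
  exists (Ordinal i1) => //=.
  by rewrite expr1; exact: transcendental_irrational.
apply/bigmax_leP; split=> [|i _]; first exact: powR_ge0.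
by apply: le_trans eE; apply: xe; rewrite -ltnS ltn_ord.
Qed.

(** The vectors (0, p ^+ j, 0, ..., 0) have size X and p-adic error 1 / X. *)
Lemma padic_lambda_ge0 n : (0 < n)%N -> (0 <= padic_lambda R n xi)%E.
Proof.
move=> n0; apply: ereal_sup_ubound; exists 0 => // B.
set j := (Num.truncn B).+1.
have X0 : 0 < (p ^ j)%:R :> R by rewrite ltr0n expn_gt0 prime_gt0.
exists (p ^ j)%:R.
  rewrite (le_trans (ltW (truncnS_gt B))) // ler_nat.
  by rewrite ltnW // ltn_expl // prime_gt1.
have pj0 : (p ^ j)%:Z != 0 by rewrite -lt0n expn_gt0 prime_gt0.
have absj : abs ((p ^ j)%:Z)%:~R = ((p ^ j)%:R)^-1.
  rewrite padic_abs_int ratp_abs_int //= pfactorK // fmorphV rmorphXn /=.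
  by rewrite ratr_nat natrX.
exists (fun i : 'I_n.+1 => if (i : nat) == 1 then (p ^ j)%:Z else 0); split.
  apply/bigmax_leP; split=> [|i _]; first exact: ltW.
  by case: ifP => // _; rewrite normr0 ltW.
have E m : abs ((0%:Z)%:~R * xi ^+ m - (p ^ j)%:Z%:~R) = ((p ^ j)%:R)^-1.
  by rewrite mul0r sub0r padic_absN.
apply/andP; split.
  apply/bigmax_gtP; right.
  have i1 : (1 < n.+1)%N by rewrite ltnS.
  by exists (Ordinal i1) => //=; rewrite E invr_gt0.
rewrite oppr0 sub0r powR_inv1; last exact: ltW.
apply/bigmax_leP; split=> [|i _]; first by rewrite invr_ge0 ltW.
rewrite /=; case: ifP => _; first by rewrite E.
by rewrite mul0r subrr padic_abs0 invr_ge0 ltW.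
Qed.

End Exponent.

(** * Integer relations and geometric progressions *)

(** Pigeonhole (Siegel's lemma for one equation): the (H + 1) ^ (k + 1) vectors
    with entries in [0, H] outnumber the possible values of their scalar product
    with x, and a is the difference of two vectors with the same value. The
    relation is cut at its last nonzero entry d. *)
Lemma linear_relation (k H N : nat) (x : nat -> int) :
    (0 < N)%N -> (forall i, (i <= k)%N -> (`|x i| <= N)%N) ->
    (2 * k.+1 * N < H.+1 ^ k)%N ->
  exists (a : nat -> int) (d : nat),
    [/\ (d <= k)%N, a d != 0, forall i, (i <= d)%N -> (`|a i| <= H)%N
      & \sum_(i < d.+1) a i * x i = 0].
Proof.
move=> N0 xN big; set M := (k.+1 * N * H)%N.
pose S (f : {ffun 'I_k.+1 -> 'I_H.+1}) : int := \sum_i (f i : nat)%:Z * x i.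
have SM f : `|S f| <= M%:Z.
  apply: le_trans (ler_norm_sum _ _ _) _.
  apply: (@le_trans _ _ (\sum_(i < k.+1) (N * H)%N%:Z)); last first.
    by rewrite sumr_const card_ord /M -mulnA PoszM -mulr_natl natz.
  apply: ler_sum => i _; rewrite normrM mulrC PoszM.
  by rewrite -!abszE ler_pM // lez_nat ?xN // -ltnS ltn_ord.
(* S f lies in [- M, M]; adding M makes it an index. *)
pose F f : 'I_(2 * M).+1 := inord (absz (S f + M%:Z)).
have /injectivePn[f [g fg Ffg]] : ~~ injectiveb F.
  apply/negP => /injectiveP /leq_card; rewrite card_ffun !card_ord.
  rewrite leqNgt => /negP; apply.
  have : ((2 * k.+1 * N).+1 * H.+1 <= H.+1 ^ k.+1)%N.
    by rewrite expnSr leq_mul2r big orbT.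
  apply: leq_trans; rewrite /M.
  set A := (k.+1 * N)%N; have : (0 < A)%N by rewrite muln_gt0.
  by rewrite -mulnA -/A; clearbody A; nia.
have Sfg : S f = S g.
  have /eqP := congr1 (@nat_of_ord _) Ffg; move: (SM f) (SM g).
  rewrite /F; move: (S f) (S g) => u v {SM F Ffg}; clearbody M => uM vM.
  by rewrite !inordK; lia.
pose b (i : nat) : int := (f (inord i) : nat)%:Z - (g (inord i) : nat)%:Z.
have [i0 bi0] : exists i : 'I_k.+1, b i != 0.
  apply/existsP; apply: contraNT fg; rewrite negb_exists => /forallP b0.
  apply/eqP/ffunP => i; apply/val_inj; have := b0 i.
  by rewrite negbK /b inord_val subr_eq0 => /eqP [].
have bS : \sum_(i < k.+1) b i * x i = 0.
  have /eqP := Sfg; rewrite -subr_eq0 /S -sumrB => /eqP E0.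
  by rewrite -[RHS]E0; apply: eq_bigr => i _; rewrite /b inord_val mulrBl.
pose P i := (i <= k)%N && (b i != 0).
have exP : exists i, P i by exists i0; rewrite /P bi0 -ltnS ltn_ord.
have maxP i : P i -> (i <= k)%N by case/andP.
case: (ex_maxnP exP maxP) => d /andP[dk bd] dmax.
exists b, d; split=> //.
  move=> i _; rewrite /b.
  have := ltn_ord (f (inord i)); have := ltn_ord (g (inord i)).
  by move: (f _ : nat) (g _ : nat) => u v; lia.
rewrite -[RHS]bS (big_ord_widen _ (fun i => b i * x i) (dk : (d.+1 <= k.+1)%N)).
rewrite [RHS](bigID (fun i : 'I_k.+1 => (i < d.+1)%N)) /=.
rewrite [X in _ = _ + X]big1 ?addr0 // => i; rewrite ltnS => /negP di.
suff /eqP -> : b i == 0 by rewrite mul0r.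
apply: contra_notT di => bi; apply: dmax.
by rewrite /P bi -ltnS ltn_ord.
Qed.

(** With x 1 / x 0 = r / q in lowest terms, the minors give
    q ^+ m * x m = x 0 * r ^+ m; for m = n coprimality forces q ^+ n to divide
    x 0. *)
Lemma geometric_of_minors (n : nat) (x : nat -> int) :
    x 0 != 0 -> (forall m, (m < n)%N -> x 0 * x m.+1 = x 1 * x m) ->
  exists t q r : int, coprimez q r /\
    forall m, (m <= n)%N -> x m = t * q ^+ (n - m) * r ^+ m.
Proof.
move=> x0 minor; set g := gcdz (x 0) (x 1).
have g0 : g != 0 by rewrite gcdz_eq0 (negPf x0).
have [q Eq] : exists q, x 0 = q * g by apply/dvdzP; exact: dvdz_gcdl.
have [r Er] : exists r, x 1 = r * g by apply/dvdzP; exact: dvdz_gcdr.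
have q0 : q != 0 by apply: contraNneq x0 => q0; rewrite Eq q0 mul0r.
have qr : coprimez q r.
  rewrite /coprimez -(inj_eq (mulIf g0)) mul1r.
  by apply/eqP; rewrite -[g in LHS]/(`|g|%:Z) mulz_gcdl -Eq -Er.
have qm m : (m <= n)%N -> q ^+ m * x m = x 0 * r ^+ m.
  elim: m => [|m IHm] mn; first by rewrite !expr0 mul1r mulr1.
  have := minor m mn; rewrite {1}Eq Er => E.
  have {}E : q * x m.+1 = r * x m by apply: (mulIf g0); rewrite mulrAC E; ring.
  by rewrite exprSr -mulrA E mulrCA IHm ?(ltnW mn) // exprS; ring.
have [t Et] : exists t, x 0 = t * q ^+ n.
  apply/dvdzP; rewrite -(@Gauss_dvdzl _ _ (r ^+ n)).
    by rewrite -qm // dvdz_mulr.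
  by rewrite coprimezXl // coprimezXr.
exists t, q, r; split=> // m mn.
apply: (mulfI (expf_neq0 m q0)); rewrite qm // Et -{1}(subnK mn) exprD; ring.
Qed.

Section LinearForms.
Variables (R : realType) (p : nat) (p_pr : prime p) (xi : padic p_pr).
Local Notation abs := (@padic_abs R p p_pr).

(** Irrationality makes each of these finitely many values nonzero. *)
Lemma bounded_linear_forms_away_from0 (N : nat) :
    ~ algebraicOver (ratr : rat -> padic p_pr) xi ->
  exists2 delta : R, 0 < delta & forall q r : int,
    q != 0 -> (`|q| <= N)%N -> (`|r| <= N)%N ->
    delta <= abs (q%:~R * xi - r%:~R).
Proof.
move=> xi_tr.
pose z (i : 'I_(2 * N).+1) : int := (i : nat)%:Z - N%:Z.
pose L (u : 'I_(2 * N).+1 * 'I_(2 * N).+1) := abs ((z u.1)%:~R * xi - (z u.2)%:~R).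
exists (\big[Num.min/1]_(u | z u.1 != 0) L u).
  apply/bigmin_gtP; split=> // u zu.
  exact: transcendental_irrational.
have zE (m : int) : (`|m| <= N)%N -> z (inord `|m + N%:Z|) = m.
  by move=> mN; rewrite /z inordK; lia.
move=> q r q0 qN rN; rewrite -(zE q qN) -(zE r rN).
by apply: (@bigmin_le_cond _ _ _ _ (inord `|q + N%:Z|, inord `|r + N%:Z|) _ L) => /=; rewrite zE.
Qed.

(** Multiplying the relation by xi ^+ j and replacing xi ^+ j * z i by z (i + j)
    costs only the errors of z. The entries of z are p-adic numbers, not just
    integers, so that z can be prolonged by exact multiples of powers of xi. *)
Lemma shifted_relation (d j : nat) (a : nat -> int) (z : nat -> padic p_pr)
    (M e : R) : 1 <= M -> abs xi <= M -> 0 <= e ->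
    (forall m, (m <= d + j)%N -> abs (z 0 * xi ^+ m - z m) <= e) ->
    \sum_(i < d.+1) (a i)%:~R * z i = 0 ->
  abs (\sum_(i < d.+1) (a i)%:~R * z (i + j)%N) <= M ^+ j * e.
Proof.
move=> M1 xiM e0 ze S0.
have Mj1 : 1 <= M ^+ j by rewrite exprn_ege1.
have Me0 : 0 <= M ^+ j * e by rewrite mulr_ge0 // (le_trans ler01).
have -> : \sum_(i < d.+1) (a i)%:~R * z (i + j)%N =
  \sum_(i < d.+1) ((a i)%:~R * (xi ^+ j * (z 0 * xi ^+ i - z i)
                         - (z 0 * xi ^+ (i + j) - z (i + j)%N))).
  transitivity (\sum_(i < d.+1) (a i)%:~R * z (i + j)%N
     - xi ^+ j * \sum_(i < d.+1) (a i)%:~R * z i).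
    by rewrite S0 mulr0 subr0.
  rewrite mulr_sumr -sumrB; apply: eq_bigr => i _.
  by rewrite exprD; ring.
apply: padic_abs_sum_le => // i _; rewrite padic_absM.
rewrite -[leRHS]mul1r ler_pM ?padic_abs_ge0 ?padic_abs_int_le1 //.
have id : (i <= d)%N by rewrite -ltnS ltn_ord.
apply: padic_absB_le.
  rewrite padic_absM padic_absX ler_pM ?exprn_ge0 ?padic_abs_ge0 //.
    by rewrite lerXn2r // nnegrE ?padic_abs_ge0 // (le_trans ler01).
  by apply: ze; rewrite (leq_trans id) // leq_addr.
by rewrite -[leLHS]mul1r ler_pM ?padic_abs_ge0 ?ze ?leq_add2r.
Qed.

End LinearForms.

(** * Passing between dimensions *)

Section Transfer.
Variables (R : realType) (p : nat) (p_pr : prime p) (xi : padic p_pr).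
Local Notation abs := (@padic_abs R p p_pr).

Local Notation M := (Num.max 1 (abs xi)).
Let M1 : 1 <= M. Proof. by rewrite le_max lexx. Qed.
Let M0 : 0 < M. Proof. exact: lt_le_trans M1. Qed.
Let xiM : abs xi <= M. Proof. by rewrite le_max lexx orbT. Qed.

(** A relation a of size r = (2 * k.+1 * X) ^ (1 / k) orthogonal to x, with last
    nonzero entry a d, determines the new coordinate: shifting it by
    j = k.+1 - d expresses a d * x 0 * xi ^+ k.+1, up to a p-adic error
    M ^+ j * e, as an integer combination of x j, ..., x k. *)
Lemma simul_approx_succ (k : nat) : (0 < k)%N ->
  exists C : R, forall (X e : R) x, 1 <= X -> 0 <= e ->
    simul_approx xi k X e x ->
    exists y, simul_approx xi k.+1 (C * X `^ (k.+1%:R / k%:R)) (C * e) y.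
Proof.
move=> k0; have kR0 : 0 < k%:R :> R by rewrite ltr0n.
set c := (2 * k.+1)%:R `^ k%:R^-1 : R.
exists (Num.max (k.+1%:R * c) (M ^+ k.+1)) => X e x X1 e0 [x0 xX xe].
set C := Num.max _ _; have X0 : 0 < X by exact: lt_le_trans X1.
have c0 : 0 <= c by exact: powR_ge0.
set r := ((2 * k.+1)%:R * X) `^ k%:R^-1.
have r0 : 0 <= r by exact: powR_ge0.
have rXE : r * X = c * X `^ (k.+1%:R / k%:R).
  rewrite /r powRM ?(ltW X0) // -/c -mulrA; congr (c * _).
  rewrite -{2}[X]powRr1 ?(ltW X0) // -powRD; last by rewrite (lt0r_neq0 X0) implybT.
  by congr (_ `^ _); rewrite -natr1; field; lra.
set N := Num.truncn X; set H := Num.truncn r.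
have HR : H%:R <= r by have /andP[] := truncn_itv r0.
have NX : N%:R <= X by have /andP[] := truncn_itv (ltW X0).
have N0 : (0 < N)%N by rewrite truncn_ge_nat // ltW.
have xN i : (i <= k)%N -> (`|x i| <= N)%N.
  move=> ik; rewrite truncn_ge_nat ?(ltW X0) //.
  by rewrite pmulrn abszE; exact: xX.
have big : (2 * k.+1 * N < H.+1 ^ k)%N.
  rewrite -(ltr_nat R) natrX natrM.
  apply: (@le_lt_trans _ _ ((2 * k.+1)%:R * X)); first by rewrite ler_wpM2l.
  have -> : (2 * k.+1)%:R * X = r ^+ k.
    rewrite -powR_mulrn // -powRrM mulVf ?lt0r_neq0 // powRr1 //.
    by rewrite mulr_ge0 // ltW.
  by rewrite ltrXn2r -?lt0n // ?nnegrE // truncnS_gt.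
have [a [d [dk ad aH aS]]] := linear_relation N0 xN big.
have aHR i : (i <= d)%N -> `|a i|%:~R <= r.
  by move=> id; apply: le_trans HR; rewrite -abszE -pmulrn ler_nat aH.
have axX i m : (i <= d)%N -> (m <= k)%N -> `|a i * x m|%:~R <= r * X.
  move=> id mk; rewrite normrM intrM ler_pM ?ler0z ?aHR ?xX //.
have krXC : k.+1%:R * (r * X) <= C * X `^ (k.+1%:R / k%:R).
  by rewrite rXE mulrA ler_wpM2r ?powR_ge0 // le_max lexx.
have rX0 : 0 <= r * X by rewrite mulr_ge0 // ltW.
have rXC : r * X <= C * X `^ (k.+1%:R / k%:R).
  by apply: le_trans krXC; rewrite ler_peMl // ler1n.
have MC : M ^+ k.+1 <= C by rewrite le_max lexx orbT.
have MeC j : (j <= k.+1)%N -> M ^+ j * e <= C * e.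
  by move=> jk; rewrite ler_wpM2r // (le_trans _ MC) // ler_weXn2l.
pose j := (k.+1 - d)%N.
have jk : (d + j = k.+1)%N by rewrite subnKC // leqW.
pose y m := if (m <= k)%N then a d * x m else - \sum_(i < d) a i * x (i + j)%N.
exists y; rewrite /y; split=> [|m|m] /=; first by rewrite mulf_neq0.
  case: (leqP m k) => [mk _|_ _]; first exact: le_trans (axX _ _ _ _) rXC.
  rewrite normrN; apply: le_trans krXC.
  apply: (@le_trans _ _ (\sum_(i < d) `|a i * x (i + j)%N|%:~R)).
    by rewrite -rmorph_sum ler_int ler_norm_sum.
  apply: (@le_trans _ _ (\sum_(i < d) r * X)).
    apply: ler_sum => i _; apply: axX; first exact: ltnW.
    by rewrite -ltnS -jk ltn_add2r.
  by rewrite sumr_const card_ord -[leLHS]mulr_natl ler_wpM2r // ler_nat leqW.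
case: (leqP m k) => [mk _|km mk1].
  rewrite !intrM -mulrA -mulrBr padic_absM.
  apply: le_trans (MeC 0%N _); rewrite // expr0.
  by rewrite ler_pM ?padic_abs_ge0 ?padic_abs_int_le1 ?xe.
have {m km mk1} -> : m = k.+1 by apply/eqP; rewrite eqn_leq mk1 km.
(* The exact value in place of the coordinate of index k.+1, which x lacks. *)
pose z m : padic p_pr := if (m <= k)%N then (x m)%:~R else (x 0)%:~R * xi ^+ m.
have zE m : (m <= d + j)%N -> abs (z 0 * xi ^+ m - z m) <= e.
  move=> _; rewrite /z /=; case: leqP => [mk|_]; first exact: xe.
  by rewrite subrr padic_abs0.
have zS : \sum_(i < d.+1) (a i)%:~R * z i = 0.
  rewrite -[RHS](rmorph0 (intmul 1 : int -> padic p_pr)) -aS rmorph_sum.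
  apply: eq_bigr => i _.
  have ik : (i <= k)%N by rewrite (leq_trans _ dk) // -ltnS ltn_ord.
  by rewrite /z ik -intrM.
have := shifted_relation M1 xiM e0 zE zS.
move=> /le_trans/(_ (MeC j _)); rewrite /j leq_subr => /(_ isT).
rewrite big_ord_recr /= -/j jk {2}/z ltnn; congr (abs _ <= _).
rewrite mulrNz opprK rmorph_sum /= intrM mulrA addrC; congr (_ + _).
apply: eq_bigr => i _; rewrite /z intrM ifT //.
by rewrite -ltnS -jk ltn_add2r.
Qed.

Lemma approx_exponent_succ (k : nat) (lam : R) :
    ~ algebraicOver (ratr : rat -> padic p_pr) xi -> (0 < k)%N ->
    approx_exponent xi k lam ->
  (((1 + lam) * (k%:R / k.+1%:R) - 1)%:E <= padic_lambda R k.+1 xi)%E.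
Proof.
move=> xi_tr k0 ex; have [C hC] := simul_approx_succ k0.
have a0 : 0 < k.+1%:R / k%:R :> R by rewrite divr_gt0 // ltr0n.
have -> : (1 + lam) * (k%:R / k.+1%:R) = (1 + lam) / (k.+1%:R / k%:R).
  by rewrite invf_div.
apply: (@padic_lambda_ge _ _ _ _ _ _ _ C) => // B.
have [X] := ex (Num.max B 1); rewrite ge_max => /andP[BX X1] [x hx].
exists X => //; have := hC X _ x X1 (powR_ge0 _ _) hx.
by rewrite opprD addrC.
Qed.

Section Descent.
Variables (n : nat) (X e : R) (x : nat -> int).
Hypotheses (n0 : (0 < n)%N) (X0 : 0 < X) (e0 : 0 <= e).
Hypothesis x_approx : simul_approx xi n X e x.

(** As xi * xi ^+ m = xi ^+ m.+1, the minor is a p-adic combination of the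
    approximation errors, hence has absolute value at most M * e; as an integer
    of size at most 2 * X ^+ 2 it must then vanish. *)
Lemma simul_approx_minor m : M * e * (2 * X ^+ 2) < 1 -> (m < n)%N ->
  x 0 * x m.+1 = x 1 * x m.
Proof.
move=> MeX mn; have [_ xX xe] := x_approx.
have X20 : 0 < 2 * X ^+ 2 by rewrite mulr_gt0 // exprn_gt0.
apply/eqP; rewrite -subr_eq0; apply/eqP.
apply: (@padic_int_eq0 R p p_pr _ _ X20).
  apply: (@le_trans _ _ (`|x 0 * x m.+1| + `|x 1 * x m|)%:~R).
    by rewrite ler_int ler_normB.
  rewrite rmorphD /= !normrM !intrM expr2 mulr_natl mulr2n.
  by rewrite lerD // ler_pM ?ler0z ?xX // ltnW.
apply: (@le_lt_trans _ _ (M * e)); last first.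
  by rewrite -[ltRHS]mul1r ltr_pdivlMr.
have e1 := xe 1%N n0; have em := xe m (ltnW mn); have em1 := xe m.+1 mn.
rewrite intrB !intrM.
set u0 : padic p_pr := (x 0)%:~R; set u1 : padic p_pr := (x 1)%:~R.
set um : padic p_pr := (x m)%:~R; set um1 : padic p_pr := (x m.+1)%:~R.
have -> : u0 * um1 - u1 * um = u0 * (xi * (u0 * xi ^+ m - um))
    + um * (u0 * xi ^+ 1 - u1) - u0 * (u0 * xi ^+ m.+1 - um1).
  by rewrite [xi ^+ m.+1]exprS; ring.
have int_le (i : nat) (t : padic p_pr) (b : R) :
    abs t <= b -> abs ((x i)%:~R * t) <= b.
  move=> tb; rewrite padic_absM -[leRHS]mul1r.
  by rewrite ler_pM ?padic_abs_ge0 ?padic_abs_int_le1.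
have eM : e <= M * e by rewrite ler_peMl.
apply: padic_absB_le; first apply: padic_absD_le.
- apply: int_le; rewrite padic_absM.
  by rewrite ler_pM ?padic_abs_ge0.
- by apply: int_le; exact: le_trans eM.
- by apply: int_le; exact: le_trans eM.
Qed.

Variables (t q r : int).
Hypotheses (t0 : t != 0) (qr : coprimez q r).
Hypothesis xE : forall m, (m <= n)%N -> x m = t * q ^+ (n - m) * r ^+ m.

Let x0E : x 0 = t * q ^+ n.
Proof. by rewrite xE // subn0 expr0 mulr1. Qed.

(** If |q * xi| < 1 and |q| < 1, then r is a p-adic unit and the last error
    has the absolute value of t, which is too large for an integer of size at
    most X. *)
Lemma geometric_denominator : `|t|%:~R <= X -> e < X^-1 -> 1 <= M * abs q%:~R.
Proof.
move=> TX eXV; have [_ _ xe] := x_approx.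
have xnE : x n = t * r ^+ n by rewrite xE // subnn expr0 mulr1.
rewrite leNgt; apply/negP => qM.
have q1 : abs q%:~R < 1.
  by apply: le_lt_trans qM; rewrite ler_peMl ?padic_abs_ge0.
have r1 := @padic_abs_coprime R p p_pr q r qr q1.
have qxi : abs (q%:~R * xi) < 1.
  by rewrite padic_absM mulrC (le_lt_trans _ qM) // ler_wpM2r ?padic_abs_ge0.
have te : e < abs t%:~R.
  by rewrite (lt_le_trans eXV) // padic_abs_int_ge.
have t_gt0 : 0 < abs t%:~R by exact: le_lt_trans te.
suff : abs (x n)%:~R < abs t%:~R.
  by rewrite xnE intrM rmorphXn padic_absM padic_absX r1 expr1n mulr1 ltxx.
have -> : (x n)%:~R = (x 0)%:~R * xi ^+ n
    - ((x 0)%:~R * xi ^+ n - (x n)%:~R) :> padic p_pr by ring.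
apply: le_lt_trans (padic_absD _ _ _) _; rewrite gt_max padic_absN.
rewrite (le_lt_trans (xe n _)) // andbT.
rewrite x0E intrM rmorphXn -mulrA -exprMn padic_absM padic_absX.
by rewrite gtr_pMr // exprn_ilt1 ?padic_abs_ge0 // -lt0n.
Qed.

(** The first error is t * q ^+ n.-1 * (q * xi - r), where |t|_p >= 1 / |t| and
    q is p-adically bounded below. *)
Lemma geometric_linear_form : 1 <= M * abs q%:~R ->
  abs (q%:~R * xi - r%:~R) <= M ^+ n * (`|t|%:~R * e).
Proof.
move=> qM; have [_ _ xe] := x_approx; set T : R := `|t|%:~R.
have T0 : 0 < T by rewrite ltr0z normr_gt0.
have E : abs t%:~R * abs q%:~R ^+ n.-1 * abs (q%:~R * xi - r%:~R) <= e.
  have := xe 1%N n0; rewrite (xE (m := 1%N)) // x0E subn1 !intrM !rmorphXn.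
  rewrite !expr1 /= -padic_absX -!padic_absM; congr (abs _ <= _).
  by rewrite -{1}(prednK n0) exprS; ring.
set L := abs (_ - _) in E *.
have L0 : 0 <= L by exact: padic_abs_ge0.
have Mq1 : 1 <= M ^+ n * abs q%:~R ^+ n.-1.
  rewrite -{1}(prednK n0) exprS -mulrA -exprMn.
  by rewrite -[leLHS]mul1r ler_pM // exprn_ege1.
have Tt1 : 1 <= T * abs t%:~R.
  by rewrite mulrC -ler_pdivrMr // mul1r padic_abs_int_ge.
apply: (@le_trans _ _ ((M ^+ n * abs q%:~R ^+ n.-1) * (T * abs t%:~R) * L)).
  rewrite -[leLHS]mul1r ler_wpM2r //.
  by rewrite -[leLHS]mul1r ler_pM.
have -> : M ^+ n * abs q%:~R ^+ n.-1 * (T * abs t%:~R) * L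
   = M ^+ n * (T * (abs t%:~R * abs q%:~R ^+ n.-1 * L)) by ring.
by rewrite ler_wpM2l ?exprn_ge0 ?(ltW M0) // ler_wpM2l // ltW.
Qed.

End Descent.

(** For lam > 1 the minors vanish, so the approximating vector is
    t * (q ^+ n, q ^+ n.-1 * r, ..., r ^+ n), and q, r approximate xi with the
    size bound Y = (X / |t|) ^ (1 / n). Irrationality of xi makes Y
    unbounded: bounded q, r would keep |q * xi - r|_p away from 0. *)
Lemma approx_exponent_descent (n : nat) (lam : R) :
    ~ algebraicOver (ratr : rat -> padic p_pr) xi -> (0 < n)%N -> 1 < lam ->
    approx_exponent xi n lam ->
  ((n%:R * (1 + lam) - 1)%:E <= padic_lambda R 1 xi)%E.
Proof.
move=> xi_tr n0 lam1 ex; have nR0 : 0 < n%:R :> R by rewrite ltr0n.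
rewrite -[n%:R * _]divr1.
apply: (@padic_lambda_ge _ _ _ _ _ _ _ (M ^+ n)) => // B.
set N := (Num.truncn B).+1.
have [delta d0 away] := @bounded_linear_forms_away_from0 R p p_pr xi N xi_tr.
have lam10 : 0 < lam - 1 by lra.
have lam0 : 0 < lam by lra.
have [B1 B11 XB1] := powR_unbounded (2 * M) lam10.
have [B2 B21 XB2] := powR_unbounded (M ^+ n / delta) lam0.
have [X] := ex (Num.max (B1 + 1) B2).
rewrite ge_max => /andP[B1X B2X] [x x_approx]; have [x0 xX _] := x_approx.
set e := X `^ (- lam - 1) in x_approx.
have X1 : 1 < X by lra.
have X0 : 0 < X by lra.
have e0 : 0 <= e by exact: powR_ge0.
have eX s : e * X `^ s = X `^ (s - lam - 1).
  rewrite /e -powRD; last by rewrite (lt0r_neq0 X0) implybT.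
  by congr (_ `^ _); lra.
have MeX : M * e * (2 * X ^+ 2) < 1.
  have -> : M * e * (2 * X ^+ 2) = (2 * M) * X `^ (- (lam - 1)).
    rewrite -powR_mulrn ?(ltW X0) // (_ : - (lam - 1) = 2 - lam - 1).
      by rewrite -eX; ring.
    by ring.
  rewrite powRN -[ltRHS](divff (lt0r_neq0 (powR_gt0 (lam - 1) X0))).
  by rewrite ltr_pM2r ?invr_gt0 ?powR_gt0 // XB1 //; lra.
have minor m := simul_approx_minor n0 X0 e0 x_approx (m := m) MeX.
have [t [q [r [qr xE]]]] := geometric_of_minors x0 minor.
have x0E : x 0 = t * q ^+ n by rewrite xE // subn0 expr0 mulr1.
have xnE : x n = t * r ^+ n by rewrite xE // subnn expr0 mulr1.
have t0 : t != 0 by apply: contraNneq x0 => t0; rewrite x0E t0 mul0r.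
have q0 : q != 0.
  by apply: contraNneq x0 => q0; rewrite x0E q0 expr0n gtn_eqF // mulr0.
set T : R := `|t|%:~R.
have T0 : 0 < T by rewrite ltr0z normr_gt0.
have T1 : 1 <= T by rewrite ler1z -gtz0_ge1 normr_gt0.
have sizeT (m : int) : `|t * m ^+ n|%:~R <= X -> T * `|m|%:~R ^+ n <= X.
  by rewrite normrM normrX intrM rmorphXn.
have qX : T * `|q|%:~R ^+ n <= X by apply: sizeT; rewrite -x0E xX.
have rX : T * `|r|%:~R ^+ n <= X by apply: sizeT; rewrite -xnE xX.
have TX : T <= X.
  apply: le_trans qX; rewrite ler_peMr ?(ltW T0) // exprn_ege1 //.
  by rewrite ler1z -gtz0_ge1 normr_gt0.
have eXV : e < X^-1.
  rewrite -powR_inv1 ?(ltW X0) // powR_lt //; lra.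
have qM := geometric_denominator n0 e0 x_approx t0 qr xE TX eXV.
have form := geometric_linear_form n0 x_approx t0 xE qM.
(* The root of X / T, rather than the maximum of |q| and |r|, is taken as size
   bound: the precision is then exactly a power of Y times a power of T. *)
set Y := (X / T) `^ n%:R^-1.
have XT0 : 0 < X / T by rewrite divr_gt0.
have Y0 : 0 < Y by rewrite powR_gt0.
have Yn : Y ^+ n = X / T.
  by rewrite -powR_mulrn ?(ltW Y0) // /Y -powRrM mulVf ?lt0r_neq0 // powRr1 // ltW.
have root_le (m : int) : T * `|m|%:~R ^+ n <= X -> `|m|%:~R <= Y.
  move=> mX; rewrite -(@ler_pXn2r _ n) // ?nnegrE ?ler0z ?(ltW Y0) //.
  by rewrite Yn ler_pdivlMr // mulrC.
have qY := root_le q qX; have rY := root_le r rX.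
exists Y.
  (* If Y < B, then |q * xi - r|_p is at least delta, whereas it is at most
     M ^+ n * T * e <= M ^+ n * X ^ (- lam). *)
  rewrite leNgt; apply/negP => YB.
  have small (m : int) : `|m|%:~R <= Y -> (`|m| <= N)%N.
    move=> mY; rewrite -(ler_nat R) pmulrn abszE (le_trans mY) //.
    by rewrite (le_trans (ltW YB)) // ltW // truncnS_gt.
  have := away q r q0 (small q qY) (small r rY).
  rewrite leNgt => /negP; apply; apply: le_lt_trans form _.
  apply: (@le_lt_trans _ _ (M ^+ n * X `^ (- lam))).
    rewrite ler_wpM2l ?exprn_ge0 ?(ltW M0) //.
    apply: (@le_trans _ _ (e * X `^ 1)).
      by rewrite powRr1 ?(ltW X0) // mulrC ler_wpM2l.
    by rewrite eX; have -> : 1 - lam - 1 = - lam by ring.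
  rewrite powRN ltr_pdivrMr ?powR_gt0 // mulrC -ltr_pdivrMr //.
  by apply: XB2.
have MnY : 1 <= M ^+ n by rewrite exprn_ege1.
exists (fun m => if m == 0%N then q else r); split=> //= m m1.
  rewrite powRr1 ?(ltW Y0) //; apply: (@le_trans _ _ Y); first by case: eqP.
  by rewrite ler_peMl // ltW.
have YE : Y `^ (- (n%:R * (1 + lam))) = T `^ (1 + lam) * e.
  rewrite -mulrN powRrM powR_mulrn ?(ltW Y0) // Yn.
  rewrite powRM ?invr_ge0 ?(ltW T0) ?(ltW X0) // mulrC -powR_inv1 ?(ltW T0) //.
  rewrite -powRrM mulN1r opprK /e; congr (_ * _ `^ _); ring.
case: m m1 => [|[|//]] _ /=.
  by rewrite expr0 mulr1 subrr padic_abs0 mulr_ge0 ?powR_ge0 // (le_trans ler01).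
rewrite expr1; apply: le_trans form _; rewrite YE ler_wpM2l ?(le_trans ler01) //.
by rewrite ler_wpM2r // le1r_powR //; lra.
Qed.

End Transfer.

(** * Comparison of the exponents *)

(** Nonnegativity of x and y rules out indeterminate sums, so that the affine
    rescaling remains valid at +oo. *)
Lemma lee_rescale (R : realType) (a b : R) (x y : \bar R) :
    0 < a -> 0 < b -> (0 <= x)%E -> (0 <= y)%E ->
  (((a%:E * x - b%:E + a%:E) / b%:E <= y)%E
     = (a%:E * (1 + x) <= b%:E * (1 + y))%E) *
  ((y <= (a%:E * x - b%:E + a%:E) / b%:E)%E
     = (b%:E * (1 + y) <= a%:E * (1 + x))%E).
Proof.
move=> a0 b0; have bn0 : b != 0 by exact: lt0r_neq0.
case: x => [r r0|_|]; last by rewrite leeNy_eq.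
- case: y => [s s0|_|]; last by rewrite leeNy_eq.
    rewrite inver (negPf bn0) -!EFinM !lee_fin.
    have -> : a * (1 + r) = ((a * r - b + a) / b + 1) * b by field.
    have -> : b * (1 + s) = (s + 1) * b by ring.
    by rewrite !(ler_pM2r b0) !lerD2r.
  rewrite addey // gt0_muley ?lte_fin // !leey.
  rewrite inver (negPf bn0) -!EFinM.
  by rewrite !leye_eq.
rewrite [(1 + +oo)%E]addey // gt0_muley ?lte_fin //.
rewrite addye // inver (negPf bn0) gt0_mulye ?lte_fin ?invr_gt0 //.
case: y => [s s0|_|]; last by rewrite leeNy_eq.
  by rewrite !leey; split.
by rewrite addey // gt0_muley ?lte_fin // !leey.
Qed.

Section Chain.
Variables (R : realType) (p : nat) (p_pr : prime p) (xi : padic p_pr).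
Hypothesis xi_tr : ~ algebraicOver (ratr : rat -> padic p_pr) xi.
Local Notation lambda n := (padic_lambda R n xi).

(** Only finite y matters, since the right-hand side is +oo otherwise. *)
Let scale_fin_le (a b : R) (x y : \bar R) : 0 < a -> 0 < b ->
  (0 <= x)%E -> (0 <= y)%E ->
  (forall s, 0 <= s -> y = s%:E -> (x <= (b * (1 + s) / a - 1)%:E)%E) ->
  (a%:E * (1 + x) <= b%:E * (1 + y))%E.
Proof.
move=> a0 b0 x0; case: y => [s s0|_ _|]; last by rewrite leeNy_eq.
  move=> /(_ s s0 erefl); case: x x0 => [r r0||]; last by rewrite leeNy_eq.
    rewrite -!EFinD -!EFinM !lee_fin => h.
    by rewrite mulrC -ler_pdivlMr //; lra.
  by rewrite leye_eq.
by rewrite addey // gt0_muley ?lte_fin // leey.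
Qed.

Lemma padic_lambda_step (k : nat) : (0 < k)%N ->
  (k%:R%:E * (1 + lambda k) <= k.+1%:R%:E * (1 + lambda k.+1))%E.
Proof.
move=> k0; have kR0 : 0 < k%:R :> R by rewrite ltr0n.
have k1R : k.+1%:R = k%:R + 1 :> R by rewrite natr1.
apply: scale_fin_le; rewrite ?ltr0n ?padic_lambda_ge0 // => s s0 sE.
apply: (@padic_lambda_le _ _ _ _ _ 0) => // [|lam lam0 ex].
  by rewrite lee_fin subr_ge0 ler_pdivlMr // k1R; nra.
have := approx_exponent_succ xi_tr k0 ex.
rewrite sE !lee_fin lerBlDr mulrA ler_pdivrMr ?ltr0n // lerBrDr.
by rewrite ler_pdivlMr //; lra.
Qed.

Lemma padic_lambda_descent (n : nat) : (0 < n)%N -> (1 < lambda n)%E ->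
  (n%:R%:E * (1 + lambda n) <= 1%:R%:E * (1 + lambda 1))%E.
Proof.
move=> n0 lam1; have nR0 : 0 < n%:R :> R by rewrite ltr0n.
apply: scale_fin_le; rewrite ?ltr0n ?padic_lambda_ge0 // => s s0 sE.
have bound lam : 1 < lam -> approx_exponent xi n lam ->
    (lam%:E <= (1%:R * (1 + s) / n%:R - 1)%:E)%E.
  move=> lam_gt1 ex.
  have := approx_exponent_descent xi_tr n0 lam_gt1 ex.
  by rewrite sE !lee_fin lerBrDr ler_pdivlMr //; lra.
apply: (@padic_lambda_le _ _ _ _ _ 1) => //.
have [lam lam_gt1 ex] := padic_lambda_gt ler01 lam1.
by apply: le_trans (bound lam lam_gt1 ex); rewrite lee_fin ltW.
Qed.

Lemma padic_lambda_chain (k n : nat) : (0 < k)%N -> (k <= n)%N ->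
  (k%:R%:E * (1 + lambda k) <= n%:R%:E * (1 + lambda n))%E.
Proof.
move=> k0; elim: n => [|n IHn]; first by rewrite leqNgt k0.
rewrite leq_eqVlt => /predU1P[<- //|]; rewrite ltnS => kn.
exact: le_trans (IHn kn) (padic_lambda_step (leq_trans k0 kn)).
Qed.

End Chain.

Theorem theorem2p7 (R : realType) (p : nat) (p_pr : prime p)
    (xi : padic p_pr)
    (xi_transcendental : ~ algebraicOver (ratr : rat -> padic p_pr) xi) :
  (forall k : nat, (0 < k)%N ->
     (k%:R%:E * (1 + padic_lambda R k xi)
        <= k.+1%:R%:E * (1 + padic_lambda R k.+1 xi))%E /\
     ((1 < padic_lambda R k.+1 xi)%E ->
        (k.+1%:R%:E * (1 + padic_lambda R k.+1 xi)
           = k%:R%:E * (1 + padic_lambda R k xi))%E)) /\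
  (forall k n : nat, (0 < k)%N -> (k <= n)%N ->
     ((k%:R%:E * padic_lambda R k xi - n%:R%:E + k%:R%:E) / n%:R%:E
        <= padic_lambda R n xi)%E /\
     ((1 < padic_lambda R n xi)%E ->
        (padic_lambda R n xi
           = (k%:R%:E * padic_lambda R k xi - n%:R%:E + k%:R%:E) / n%:R%:E)%E)).
Proof.
have chain := @padic_lambda_chain R p p_pr xi xi_transcendental.
have back k n : (0 < k)%N -> (k <= n)%N -> (1 < padic_lambda R n xi)%E ->
    (n%:R%:E * (1 + padic_lambda R n xi)
       <= k%:R%:E * (1 + padic_lambda R k xi))%E.
  move=> k0 kn lam1; apply: le_trans (chain 1%N k isT k0).
  by apply: padic_lambda_descent => //; exact: leq_trans kn.
split=> [k k0|k n k0 kn].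
  split=> [|lam1]; first exact: chain.
  by apply/eqP; rewrite eq_le back //=; exact: chain.
have n0 : (0 < n)%N by exact: leq_trans kn.
have E := @lee_rescale R k%:R n%:R (padic_lambda R k xi) (padic_lambda R n xi).
rewrite !ltr0n !padic_lambda_ge0 // in E; have {}E := E k0 n0 isT isT.
split=> [|lam1]; first by rewrite E chain.
by apply/eqP; rewrite eq_le !E back //=; exact: chain.
Qed.
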